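(* Let $p,q:[a,\infty)\to(0,\infty)$ be continuous, $a\ge 0$, and consider the equation (A): $(p(t)x')'=q(t)x$. Assume that $\int_a^\infty\frac{dt}{p(t)}<\infty$ and $\int_a^\infty q(t)\,dt=\infty$, and put $\pi(t)=\int_t^\infty\frac{ds}{p(s)}$, $Q(t)=\int_a^t q(s)\,ds$. Suppose that $$\int_a^\infty q(t)\pi(t)\,dt=\infty\qquad\Bigl(\text{or equivalently } \int_a^\infty\frac{Q(t)}{p(t)}\,dt=\infty\Bigr)$$ and that there is a constant $\gamma\in(0,1)$ such that $$\int_t^\infty q(s)\pi(s)^2\,ds\le\gamma\pi(t)\quad\text{for all large } t.$$ Then (A) possesses a positive decaying extreme solution $x(t)$, i.e. a positive solution satisfying $x(\infty)=Dx(\infty)=0$.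
   Context: Solutions of (A) are nontrivial real solutions defined on some interval $[T,\infty)$, $T\ge a$. $Dx(t)=p(t)x'(t)$, $x(\infty)=\lim_{t\to\infty}x(t)$, $Dx(\infty)=\lim_{t\to\infty}Dx(t)$. A solution is extreme if either $|x(\infty)|=|Dx(\infty)|=0$ (decaying) or $|x(\infty)|=|Dx(\infty)|=\infty$ (growing). *)

(* Defs.v *)
From Stdlib Require Import Reals.
From Coquelicot Require Import Coquelicot.
Open Scope R_scope.

Definition half_line (a : R) : R -> Prop := fun t => a <= t.

(* Same as [is_derive], with the filter restricted to [D]: on [half_line T] it is
   the two-sided derivative at t > T and the right derivative at t = T. *)
Definition is_derive_within (D : R -> Prop) (f : R -> R) (t l : R) : Prop :=
  filterdiff f (within D (locally t)) (fun h : R => scal h l).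

Definition converges_int (f : R -> R) (a : R) : Prop :=
  ex_RInt_gen f (at_point a) (Rbar_locally p_infty).

(* Meaningful only under [converges_int f a]. *)
Definition int_to_infty (f : R -> R) (a : R) : R :=
  RInt_gen f (at_point a) (Rbar_locally p_infty).

(* Used for integrands continuous on [a, oo), so that [RInt] is the actual
   integral over [a, t] for every t >= a. *)
Definition int_infinite (f : R -> R) (a : R) : Prop :=
  is_lim (fun t => RInt f a t) p_infty p_infty.

Definition pi_tail (p : R -> R) (t : R) : R := int_to_infty (fun s => / p s) t.

Definition Q_int (q : R -> R) (a t : R) : R := RInt q a t.

Definition quasi_deriv (p dx : R -> R) (t : R) : R := p t * dx t.

(* [x] is a nontrivial solution of (p x')' = q x on [T, oo), and [dx] is its
   derivative x' there. *)
Definition is_solution (p q : R -> R) (T : R) (x dx : R -> R) : Prop :=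
  (exists t, T <= t /\ x t <> 0) /\
  (forall t, T <= t ->
     is_derive_within (half_line T) x t (dx t) /\
     is_derive_within (half_line T) (quasi_deriv p dx) t (q t * x t)).

Definition is_decaying (p x dx : R -> R) : Prop :=
  is_lim x p_infty 0 /\ is_lim (quasi_deriv p dx) p_infty 0.

(* Main.v *)
Require Import Defs.
From Stdlib Require Import Reals Lra Lia Classical PSeries_reg Ranalysis5.
From Coquelicot Require Import Coquelicot.
Open Scope R_scope.

(** Write P = 1/p and y = Dx, so that the equation becomes the linear
    system x' = P y, y' = q x with nonnegative coefficients.

    The equivalence of the two divergence conditions is integration by parts,
    the integral of q pi over [a, t] being Q(t) pi(t) plus the integral of Q P.
    The boundary term is nonnegative, and since Q is nondecreasing
    Q(t) (pi(t) - pi(s)) is at most the integral of Q P over [t, s]; hence, when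
    the integral of Q P stays bounded, so does Q pi
    ([divergence_equivalence]).

    The decaying solution comes from reduction of order. The system has a
    solution (u, v) with u >= 1 and v >= 0 ([linear_system_solution]); with G
    the integral of P / u^2 from a and c its supremum, finite because u >= 1 and
    P is integrable, x = u (c - G) is a positive solution with y = v (c - G) - 1/u <= 0
    ([positive_decreasing_solution]). Now -y and x are nonnegative and
    nonincreasing, and the loss of -y over [a, t] is the integral of q x, which
    therefore stays bounded. If x >= eps > 0, this contradicts the divergence
    of the integral of q, so x tends to 0. If -y >= eps > 0, integrating x' and
    using that x is positive gives x >= eps pi, which contradicts the divergence
    of the integral of q pi, so y tends to 0 ([decaying_solution]).

    The coefficients are only given on [a, oo). Extending them to the left by
    their value at a makes them continuous on the whole line, so that all derivatives in the
    argument are two-sided; the solution is restricted to [a, oo) at the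
    end. *)

(** * Monotonicity and differentiation of integrals *)

Lemma nondecreasing_of_derive (f df : R -> R) (T : R) :
  (forall t, T <= t -> is_derive f t (df t)) ->
  (forall t, T <= t -> 0 <= df t) ->
  forall s t, T <= s <= t -> f s <= f t.
Proof.
  intros Hf Hdf s t Hst.
  destruct (MVT_gen f s t df) as [c [Hc Heq]].
  - intros x; rewrite Rmin_left, Rmax_right by lra; intros Hx; apply Hf; lra.
  - intros x; rewrite Rmin_left, Rmax_right by lra; intros Hx.
    apply derivable_continuous_pt; exists (df x).
    apply is_derive_Reals, Hf; lra.
  - rewrite Rmin_left, Rmax_right in Hc by lra.
    assert (0 <= df c * (t - s)) by (apply Rmult_le_pos; [apply Hdf|]; lra).
    lra.
Qed.

Lemma nonincreasing_of_derive (f df : R -> R) (T : R) :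
  (forall t, T <= t -> is_derive f t (df t)) ->
  (forall t, T <= t -> df t <= 0) ->
  forall s t, T <= s <= t -> f t <= f s.
Proof.
  intros Hf Hdf s t Hst.
  enough (- f s <= - f t) by lra.
  apply (nondecreasing_of_derive (fun t => - f t) (fun t => - df t) T); try easy.
  - intros u Hu; apply (is_derive_opp f), Hf, Hu.
  - intros u Hu; specialize (Hdf u Hu); lra.
Qed.

Lemma is_derive_RInt_ray (f : R -> R) (t0 a t : R) :
  (forall s, t0 < s -> continuous f s) -> t0 < a -> t0 < t ->
  is_derive (fun u => RInt f a u) t (f t).
Proof.
  intros Hf Ha Ht.
  apply is_derive_RInt with a; [|apply Hf, Ht].
  assert (Hd : 0 < t - t0) by lra.
  exists (mkposreal _ Hd); intros u Hu.
  unfold ball in Hu; simpl in Hu; unfold AbsRing_ball, abs, minus, plus, opp in Hu; simpl in Hu.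
  apply Rabs_def2 in Hu.
  apply (RInt_correct f), ex_RInt_continuous; intros z Hz.
  apply Hf; revert Hz; unfold Rmin; destruct (Rle_dec a u); lra.
Qed.

Lemma is_derive_RInt_continuous (f : R -> R) (a t : R) :
  (forall s, continuous f s) -> is_derive (fun u => RInt f a u) t (f t).
Proof.
  intros Hf; apply is_derive_RInt_ray with (Rmin a t - 1); try easy.
  - pose proof (Rmin_l a t); lra.
  - pose proof (Rmin_r a t); lra.
Qed.

Lemma is_derive_continuous (f : R -> R) (t l : R) :
  is_derive f t l -> continuous f t.
Proof. intros H; apply (ex_derive_continuous f); now exists l. Qed.

Lemma continuous_Rmult (f g : R -> R) (t : R) :
  continuous f t -> continuous g t -> continuous (fun s => f s * g s) t.
Proof. apply (continuous_mult f g). Qed.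

Lemma is_derive_const_minus (f : R -> R) (c t l : R) :
  is_derive f t l -> is_derive (fun s => c - f s) t (- l).
Proof.
  intros H; evar_last.
  - apply (is_derive_minus (fun _ => c) f); [apply is_derive_const|exact H].
  - unfold minus, plus, opp, zero; simpl; ring.
Qed.

(** * The linear system u' = P v, v' = q u *)

Fixpoint picard (P q : R -> R) (t0 : R) (n : nat) : (R -> R) * (R -> R) :=
  match n with
  | O => (fun _ => 1, fun _ => 0)
  | S m =>
      (fun t => 1 + RInt (fun s => P s * snd (picard P q t0 m) s) t0 t,
       fun t => RInt (fun s => q s * fst (picard P q t0 m) s) t0 t)
  end.

Section Picard.
Variables (P q : R -> R) (t0 : R).
Hypothesis HP : forall t, continuous P t.
Hypothesis Hq : forall t, continuous q t.
Hypothesis HP0 : forall t, 0 <= P t.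
Hypothesis Hq0 : forall t, 0 <= q t.

Let X n := fst (picard P q t0 n).
Let Y n := snd (picard P q t0 n).

Lemma picard_continuous n t : continuous (X n) t /\ continuous (Y n) t.
Proof.
  revert t; induction n as [|n IH]; intros t.
  - split; apply continuous_const.
  - split.
    + apply (continuous_plus (fun _ => 1)); [apply continuous_const|].
      eapply is_derive_continuous, (is_derive_RInt_continuous (fun s => P s * Y n s)).
      intros s; apply continuous_Rmult; [apply HP|apply IH].
    + eapply is_derive_continuous, (is_derive_RInt_continuous (fun s => q s * X n s)).
      intros s; apply continuous_Rmult; [apply Hq|apply IH].
Qed.

Lemma picard_derive n t :
  is_derive (X (S n)) t (P t * Y n t) /\ is_derive (Y (S n)) t (q t * X n t).
Proof.
  split.
  - evar_last.
    + apply (is_derive_plus (fun _ => 1)); [apply is_derive_const|].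
      apply (is_derive_RInt_continuous (fun s => P s * Y n s)).
      intros s; apply continuous_Rmult; [apply HP|apply picard_continuous].
    + apply plus_zero_l.
  - apply (is_derive_RInt_continuous (fun s => q s * X n s)).
    intros s; apply continuous_Rmult; [apply Hq|apply picard_continuous].
Qed.

Lemma picard_start n : X n t0 = 1 /\ Y n t0 = 0.
Proof.
  destruct n as [|n]; [easy|].
  unfold X, Y; simpl; rewrite !RInt_point; unfold zero; simpl; lra.
Qed.

Lemma picard_nonneg n t : t0 <= t -> 1 <= X n t /\ 0 <= Y n t.
Proof.
  revert t; induction n as [|n IH]; intros t Ht; [unfold X, Y; simpl; lra|].
  destruct (picard_start (S n)) as [EX EY].
  split.
  - rewrite <- EX.
    apply (nondecreasing_of_derive _ (fun t => P t * Y n t) t0); [|intros u Hu|lra].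
    + intros u _; apply picard_derive.
    + apply Rmult_le_pos; [apply HP0|now apply IH].
  - rewrite <- EY.
    apply (nondecreasing_of_derive _ (fun t => q t * X n t) t0); [|intros u Hu|lra].
    + intros u _; apply picard_derive.
    + apply Rmult_le_pos; [apply Hq0|].
      apply Rle_trans with 1; [lra|now apply IH].
Qed.

(** Bielecki weight: integrating (P + q) E gives at most E / 2, so that each
    Picard step halves distances measured relative to E, uniformly on the
    half-line and without factorials. *)
Let E t := exp (2 * RInt (fun s => P s + q s) t0 t).

Lemma weight_derive t : is_derive E t (2 * (P t + q t) * E t).
Proof.
  assert (H := is_derive_RInt_continuous (fun s => P s + q s) t0 t
                 (fun s => continuous_plus P q s (HP s) (Hq s))).
  evar_last.
  - apply (is_derive_comp exp (fun u => 2 * RInt (fun s => P s + q s) t0 u)).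
    + apply is_derive_exp.
    + apply (is_derive_scal _ t 2 _ H).
  - reflexivity.
Qed.

Lemma weight_start : E t0 = 1.
Proof. unfold E; rewrite RInt_point; unfold zero; simpl; rewrite Rmult_0_r; apply exp_0. Qed.

Lemma weight_pos t : 0 < E t.
Proof. apply exp_pos. Qed.

(** One Picard step in the weighted norm: E / 2^(n+1) has derivative
    (P + q) E / 2^n, which dominates [df], so it stays above both f and - f. *)
Lemma weight_increment (f df : R -> R) (n : nat) :
  (forall t, t0 <= t -> is_derive f t (df t)) -> f t0 = 0 ->
  (forall t, t0 <= t -> Rabs (df t) <= (P t + q t) * (E t / 2 ^ n)) ->
  forall t, t0 <= t -> Rabs (f t) <= E t / 2 ^ S n.
Proof.
  intros Hf Hf0 Hdf t Ht.
  assert (H2 : 0 < 2 ^ n) by (apply pow_lt; lra).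
  assert (HE : 0 < E t0 / 2 ^ S n).
  { apply Rdiv_lt_0_compat; [apply weight_pos|apply pow_lt; lra]. }
  assert (HdE : forall u, is_derive (fun u => E u / 2 ^ S n) u ((P u + q u) * (E u / 2 ^ n))).
  { intros u; assert (H := weight_derive u).
    auto_derive; [now eexists; apply H|].
    replace (Derive _ u) with (2 * (P u + q u) * E u) by (symmetry; apply is_derive_unique, H).
    simpl; field; lra. }
  apply Rabs_le; split.
  - enough (E t0 / 2 ^ S n + f t0 <= E t / 2 ^ S n + f t) by lra.
    apply (nondecreasing_of_derive (fun u => E u / 2 ^ S n + f u)
             (fun u => (P u + q u) * (E u / 2 ^ n) + df u) t0); [| |lra].
    + intros u Hu; apply (is_derive_plus (fun u => E u / 2 ^ S n) f); [apply HdE|now apply Hf].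
    + intros u Hu; specialize (Hdf u Hu); apply Rabs_le_between in Hdf; lra.
  - enough (E t0 / 2 ^ S n - f t0 <= E t / 2 ^ S n - f t) by lra.
    apply (nondecreasing_of_derive (fun u => E u / 2 ^ S n - f u)
             (fun u => (P u + q u) * (E u / 2 ^ n) - df u) t0); [| |lra].
    + intros u Hu; apply (is_derive_minus (fun u => E u / 2 ^ S n) f); [apply HdE|now apply Hf].
    + intros u Hu; specialize (Hdf u Hu); apply Rabs_le_between in Hdf; lra.
Qed.

Lemma picard_increment n t : t0 <= t ->
  Rabs (X (S n) t - X n t) <= E t / 2 ^ n /\ Rabs (Y (S n) t - Y n t) <= E t / 2 ^ n.
Proof.
  revert t; induction n as [|n IH]; intros t Ht.
  - assert (H1 : X 1 t - X 0 t = 0).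
    { unfold X; simpl.
      rewrite (RInt_ext _ (fun _ => 0)), RInt_const by (intros; apply Rmult_0_r).
      unfold scal; simpl; unfold mult; simpl; ring. }
    rewrite H1, Rabs_R0; simpl; rewrite Rdiv_1_r.
    split; [apply Rlt_le, weight_pos|].
    assert (0 <= Y 1 t) by now apply picard_nonneg.
    change (Y 0 t) with 0; rewrite Rminus_0_r, Rabs_pos_eq by easy.
    pose proof weight_start; destruct (picard_start 1).
    enough (E t0 - Y 1 t0 <= E t - Y 1 t) by lra.
    apply (nondecreasing_of_derive (fun u => E u - Y 1 u)
             (fun u => 2 * (P u + q u) * E u - q u * 1) t0); [| |lra].
    + intros u Hu; apply (is_derive_minus E (Y 1)); [apply weight_derive|apply picard_derive].
    + intros u Hu.
      assert (1 <= E u).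
      { rewrite <- weight_start.
        apply (nondecreasing_of_derive E (fun u => 2 * (P u + q u) * E u) t0); [| |lra].
        - intros v _; apply weight_derive.
        - intros v _; specialize (HP0 v); specialize (Hq0 v).
          apply Rmult_le_pos; [lra|apply Rlt_le, weight_pos]. }
      specialize (HP0 u); specialize (Hq0 u); nra.
  - assert (HE : forall u, 0 <= E u / 2 ^ n).
    { intros u; apply Rlt_le, Rdiv_lt_0_compat; [apply weight_pos|apply pow_lt; lra]. }
    split.
    + apply (weight_increment (fun u => X (S (S n)) u - X (S n) u)
               (fun u => P u * Y (S n) u - P u * Y n u)); try easy.
      * intros u _; apply (is_derive_minus (X (S (S n)))); apply picard_derive.
      * destruct (picard_start (S (S n))), (picard_start (S n)); lra.
      * intros u Hu; rewrite <- Rmult_minus_distr_l, Rabs_mult.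
        rewrite (Rabs_pos_eq (P u)) by apply HP0.
        apply Rmult_le_compat; [apply HP0|apply Rabs_pos| |now apply IH].
        specialize (Hq0 u); lra.
    + apply (weight_increment (fun u => Y (S (S n)) u - Y (S n) u)
               (fun u => q u * X (S n) u - q u * X n u)); try easy.
      * intros u _; apply (is_derive_minus (Y (S (S n)))); apply picard_derive.
      * destruct (picard_start (S (S n))), (picard_start (S n)); lra.
      * intros u Hu; rewrite <- Rmult_minus_distr_l, Rabs_mult.
        rewrite (Rabs_pos_eq (q u)) by apply Hq0.
        apply Rmult_le_compat; [apply Hq0|apply Rabs_pos| |now apply IH].
        specialize (HP0 u); lra.
Qed.
End Picard.

(** * Limits of geometrically convergent sequences *)

Lemma geometric_small (K eps : R) : 0 < eps ->
  exists N, forall n, (N <= n)%nat -> K / 2 ^ n < eps.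
Proof.
  intros Heps.
  assert (HK : 0 < eps / (Rabs K + 1)).
  { apply Rdiv_lt_0_compat; [easy|]; pose proof (Rabs_pos K); lra. }
  destruct (pow_lt_1_zero (/ 2)) with (eps / (Rabs K + 1)) as [N HN]; try easy.
  { rewrite Rabs_pos_eq; lra. }
  exists N; intros n Hn; specialize (HN n Hn).
  rewrite pow_inv in HN.
  assert (H2 : 0 < / 2 ^ n) by (apply Rinv_0_lt_compat, pow_lt; lra).
  rewrite Rabs_pos_eq in HN by lra.
  pose proof (Rle_abs K); pose proof (Rabs_pos K).
  apply Rlt_div_r in HN; [|lra].
  unfold Rdiv; nra.
Qed.

(** The limit is given as [Lim_seq] so that it can be taken pointwise in a
    sequence of functions without choosing a limit at each point. *)
Lemma geometric_limit (u : nat -> R) (C : R) :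
  (forall n, Rabs (u (S n) - u n) <= C / 2 ^ n) ->
  forall n, Rabs (u n - real (Lim_seq u)) <= 2 * C / 2 ^ n.
Proof.
  intros Hu.
  assert (Hdist : forall n k, Rabs (u (n + k)%nat - u n) <= 2 * C / 2 ^ n - 2 * C / 2 ^ (n + k)).
  { intros n k; induction k as [|k IH].
    - rewrite Nat.add_0_r, Rminus_diag, Rabs_R0; lra.
    - rewrite Nat.add_succ_r.
      replace (u (S (n + k)) - u n)
        with (u (S (n + k)) - u (n + k)%nat + (u (n + k)%nat - u n)) by ring.
      eapply Rle_trans; [apply Rabs_triang|].
      specialize (Hu (n + k)%nat).
      replace (2 * C / 2 ^ S (n + k)) with (C / 2 ^ (n + k))
        by (simpl; field; apply pow_nonzero; lra).
      lra. }
  assert (HC : 0 <= C).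
  { specialize (Hu O); simpl in Hu; pose proof (Rabs_pos (u 1%nat - u O)); lra. }
  assert (Hpos : forall n, 0 <= 2 * C / 2 ^ n).
  { intros n; apply Rle_mult_inv_pos; [lra|apply pow_lt; lra]. }
  assert (Hlim : ex_finite_lim_seq u).
  { apply ex_lim_seq_cauchy_corr; intros eps.
    destruct (geometric_small (4 * C) eps) as [N HN]; [apply cond_pos|].
    exists N; intros n m Hn Hm; specialize (HN N (le_n N)).
    assert (H1 := Hdist N (n - N)%nat); assert (H2 := Hdist N (m - N)%nat).
    replace (N + (n - N))%nat with n in H1 by lia.
    replace (N + (m - N))%nat with m in H2 by lia.
    pose proof (Hpos n); pose proof (Hpos m).
    replace (u n - u m) with ((u n - u N) - (u m - u N)) by ring.
    eapply Rle_lt_trans; [apply Rabs_triang|rewrite Rabs_Ropp]; lra. }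
  apply Lim_seq_correct' in Hlim; intros n.
  rewrite Rabs_minus_sym.
  enough (Rbar_le (Rabs (Lim_seq u - u n)) (2 * C / 2 ^ n)) by easy.
  apply is_lim_seq_le with (fun k => Rabs (u (k + n)%nat - u n)) (fun _ => 2 * C / 2 ^ n).
  - intros k; specialize (Hdist n k); rewrite Nat.add_comm in Hdist |- *.
    specialize (Hpos (n + k)%nat); rewrite (Nat.add_comm k n) in *; lra.
  - apply (is_lim_seq_abs _ (Finite (Lim_seq u - u n))).
    apply is_lim_seq_minus'; [now apply is_lim_seq_incr_n|apply is_lim_seq_const].
  - apply is_lim_seq_const.
Qed.

Lemma geometric_limit_ge (u : nat -> R) (l C m : R) :
  (forall n, Rabs (u n - l) <= C / 2 ^ n) -> (forall n, m <= u n) -> m <= l.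
Proof.
  intros Hu Hm; apply Rnot_lt_le; intros Hlt.
  destruct (geometric_small C (m - l)) as [N HN]; [lra|].
  specialize (HN N (le_n N)); specialize (Hu N); specialize (Hm N).
  apply Rabs_le_between in Hu; lra.
Qed.

(** [C] is continuous, hence bounded on compact intervals, so the convergence is
    locally uniform and differentiation commutes with the limit. *)
Lemma is_derive_geometric_limit (f g : nat -> R -> R) (F G C : R -> R) (t0 : R) :
  (forall n t, is_derive (f n) t (g n t)) ->
  (forall n t, continuous (g n) t) ->
  (forall t, continuous C t) ->
  (forall n t, t0 <= t -> Rabs (f n t - F t) <= C t / 2 ^ n) ->
  (forall n t, t0 <= t -> Rabs (g n t - G t) <= C t / 2 ^ n) ->
  forall t, t0 < t -> is_derive F t (G t).
Proof.
  intros Hfg Hg HC HF HG t Ht.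
  assert (Hr : 0 < t - t0) by lra.
  set (r := mkposreal _ Hr).
  assert (Hball : forall y, Boule t r y -> t0 <= y <= 2 * t - t0).
  { intros y Hy; apply Rabs_def2 in Hy; simpl in Hy; lra. }
  assert (Hcvu : CVU g G t r).
  { destruct (continuity_ab_maj C t0 (2 * t - t0)) as [m [Hm _]]; [lra| |].
    { intros c _; apply continuity_pt_filterlim, HC. }
    intros eps Heps; destruct (geometric_small (C m) eps Heps) as [N HN].
    exists N; intros n y Hn Hy; apply Hball in Hy.
    rewrite Rabs_minus_sym.
    eapply Rle_lt_trans; [now apply HG|].
    eapply Rle_lt_trans; [|apply (HN n Hn)].
    apply Rmult_le_compat_r; [|now apply Hm].
    apply Rlt_le, Rinv_0_lt_compat, pow_lt; lra. }
  apply is_derive_Reals.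
  apply (derivable_pt_lim_CVU f g F G t t r).
  - unfold Boule; rewrite Rminus_diag, Rabs_R0; apply cond_pos.
  - intros y n _; apply is_derive_Reals, Hfg.
  - intros y Hy eps Heps; apply Hball in Hy.
    destruct (geometric_small (C y) eps Heps) as [N HN].
    exists N; intros n Hn; unfold Rdist.
    eapply Rle_lt_trans; [now apply HF|now apply HN].
  - exact Hcvu.
  - apply (CVU_continuity g G t r Hcvu).
    intros n y _; apply continuity_pt_filterlim, Hg.
Qed.

(** The Picard iterates satisfy the inequalities 1 <= u and 0 <= v from [t0]
    on, because P and q are nonnegative, and pass them on to their limit. The conclusion is on the
    open half-line, where the derivatives are two-sided. *)
Lemma linear_system_solution (P q : R -> R) (t0 : R) :
  (forall t, continuous P t) -> (forall t, continuous q t) ->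
  (forall t, 0 <= P t) -> (forall t, 0 <= q t) ->
  exists u v : R -> R, forall t, t0 < t ->
    is_derive u t (P t * v t) /\ is_derive v t (q t * u t) /\ 1 <= u t /\ 0 <= v t.
Proof.
  intros HP Hq HP0 Hq0.
  set (X n := fst (picard P q t0 n)); set (Y n := snd (picard P q t0 n)).
  set (E t := exp (2 * RInt (fun s => P s + q s) t0 t)).
  set (u t := real (Lim_seq (fun n => X n t))).
  set (v t := real (Lim_seq (fun n => Y n t))).
  (* One bound for the errors of X, Y, P Y and q X at once. *)
  set (C t := (1 + P t + q t) * (2 * E t)).
  assert (Hinc := picard_increment P q t0 HP Hq HP0 Hq0).
  assert (Hu : forall n t, t0 <= t -> Rabs (X n t - u t) <= 2 * E t / 2 ^ n).
  { intros n t Ht; apply (geometric_limit (fun n => X n t)); intros k; now apply Hinc. }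
  assert (Hv : forall n t, t0 <= t -> Rabs (Y n t - v t) <= 2 * E t / 2 ^ n).
  { intros n t Ht; apply (geometric_limit (fun n => Y n t)); intros k; now apply Hinc. }
  assert (HEpos : forall t, 0 < E t) by (intros t; apply exp_pos).
  assert (H2 : forall n, 0 < / 2 ^ n) by (intros n; apply Rinv_0_lt_compat, pow_lt; lra).
  assert (HE2 : forall n t, 0 <= 2 * E t / 2 ^ n).
  { intros n t; specialize (HEpos t); apply Rmult_le_pos; [lra|apply Rlt_le, H2]. }
  assert (HC : forall t, continuous C t).
  { intros t; apply continuous_Rmult.
    - apply (continuous_plus (fun t => 1 + P t) q); [|apply Hq].
      apply (continuous_plus (fun t => 1) P); [apply continuous_const|apply HP].
    - apply continuous_Rmult; [apply continuous_const|].
      eapply is_derive_continuous, weight_derive; easy. }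
  assert (HCE : forall c n t, 0 <= c <= 1 + P t + q t -> c * (2 * E t / 2 ^ n) <= C t / 2 ^ n).
  { intros c n t Hc; unfold C, Rdiv; rewrite (Rmult_assoc (1 + P t + q t)).
    apply Rmult_le_compat_r; [apply HE2|lra]. }
  assert (HX : forall n t, t0 <= t -> Rabs (X (S n) t - u t) <= C t / 2 ^ n).
  { intros n t Ht; specialize (HP0 t); specialize (Hq0 t).
    eapply Rle_trans; [now apply Hu|].
    eapply Rle_trans; [|apply (HCE 1); lra].
    assert (0 < 2 ^ n) by (apply pow_lt; lra).
    specialize (HE2 n t).
    replace (2 * E t / 2 ^ S n) with (2 * E t / 2 ^ n / 2) by (simpl; field; lra); lra. }
  assert (HY : forall n t, t0 <= t -> Rabs (Y (S n) t - v t) <= C t / 2 ^ n).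
  { intros n t Ht; specialize (HP0 t); specialize (Hq0 t).
    eapply Rle_trans; [now apply Hv|].
    eapply Rle_trans; [|apply (HCE 1); lra].
    assert (0 < 2 ^ n) by (apply pow_lt; lra).
    specialize (HE2 n t).
    replace (2 * E t / 2 ^ S n) with (2 * E t / 2 ^ n / 2) by (simpl; field; lra); lra. }
  exists u, v; intros t Ht; split; [|split; [|split]].
  - apply (is_derive_geometric_limit (fun n => X (S n)) (fun n s => P s * Y n s) u
             (fun s => P s * v s) C t0); try easy.
    + intros n s; now apply picard_derive.
    + intros n s; apply continuous_Rmult; [apply HP|now apply picard_continuous].
    + intros n s Hs; rewrite <- Rmult_minus_distr_l, Rabs_mult, (Rabs_pos_eq (P s)) by easy.
      apply Rle_trans with (P s * (2 * E s / 2 ^ n)).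
      * apply Rmult_le_compat_l; [apply HP0|now apply Hv].
      * apply HCE; specialize (HP0 s); specialize (Hq0 s); lra.
  - apply (is_derive_geometric_limit (fun n => Y (S n)) (fun n s => q s * X n s) v
             (fun s => q s * u s) C t0); try easy.
    + intros n s; now apply picard_derive.
    + intros n s; apply continuous_Rmult; [apply Hq|now apply picard_continuous].
    + intros n s Hs; rewrite <- Rmult_minus_distr_l, Rabs_mult, (Rabs_pos_eq (q s)) by easy.
      apply Rle_trans with (q s * (2 * E s / 2 ^ n)).
      * apply Rmult_le_compat_l; [apply Hq0|now apply Hu].
      * apply HCE; specialize (HP0 s); specialize (Hq0 s); lra.
  - apply (geometric_limit_ge (fun n => X n t) (u t) (2 * E t)); intros n.
    + apply Hu; lra.
    + apply picard_nonneg; try easy; lra.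
  - apply (geometric_limit_ge (fun n => Y n t) (v t) (2 * E t)); intros n.
    + apply Hv; lra.
    + apply picard_nonneg; try easy; lra.
Qed.

(** * Limits of monotone functions at infinity *)

Lemma is_lim_0_nonincreasing (f : R -> R) (T : R) :
  (forall s t, T <= s <= t -> f t <= f s) ->
  (forall t, T <= t -> 0 <= f t) ->
  (forall eps, 0 < eps -> ~ forall t, T <= t -> eps <= f t) ->
  is_lim f p_infty 0.
Proof.
  intros Hdec Hpos Hsmall; apply is_lim_spec; intros eps; simpl.
  apply NNPP; intros Hno; apply (Hsmall eps (cond_pos eps)).
  intros t Ht; apply Rnot_lt_le; intros Hlt; apply Hno.
  exists t; intros s Hs.
  specialize (Hdec t s ltac:(lra)); specialize (Hpos s ltac:(lra)).
  rewrite Rminus_0_r, Rabs_pos_eq; lra.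
Qed.

Lemma is_lim_p_infty_nondecreasing (f : R -> R) (T : R) :
  (forall s t, T <= s <= t -> f s <= f t) ->
  (forall B, ~ forall t, T <= t -> f t <= B) ->
  is_lim f p_infty p_infty.
Proof.
  intros Hinc Hunb; apply is_lim_spec; intros B; simpl.
  apply NNPP; intros Hno; apply (Hunb B).
  intros t Ht; apply Rnot_lt_le; intros Hlt; apply Hno.
  exists t; intros s Hs; specialize (Hinc t s ltac:(lra)); lra.
Qed.

Lemma is_lim_p_infty_unbounded (f : R -> R) (T B : R) :
  is_lim f p_infty p_infty -> ~ forall t, T <= t -> f t <= B.
Proof.
  intros Hf Hle; apply is_lim_spec in Hf; destruct (Hf B) as [M HM].
  pose proof (Rmax_l T M); pose proof (Rmax_r T M).
  specialize (HM (Rmax T M + 1) ltac:(lra)); specialize (Hle (Rmax T M + 1) ltac:(lra)); lra.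
Qed.

(** * The decaying solution *)

(** Reduction of order: if G' = P / u^2, then x = u (c - G) solves the same
    equation as u, with y = v (c - G) - 1/u. Taking c = sup G makes x positive;
    this c is the right one for y <= 0 as well, because
    v(s) (G(t) - G(s)) <= 1/u(s) - 1/u(t) for s <= t, as v is nondecreasing and 1/u has
    derivative - v G'. *)
Lemma positive_decreasing_solution (P q : R -> R) (a B : R) :
  (forall t, continuous P t) -> (forall t, continuous q t) ->
  (forall t, 0 < P t) -> (forall t, 0 <= q t) ->
  (forall t, a <= t -> RInt P a t <= B) ->
  exists x y : R -> R, forall t, a <= t ->
    is_derive x t (P t * y t) /\ is_derive y t (q t * x t) /\ 0 < x t /\ y t <= 0.
Proof.
  intros HP Hq HP0 Hq0 HB.
  (* Starting before a gives two-sided derivatives at a itself. *)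
  destruct (linear_system_solution P q (a - 1)) as [u [v Huv]]; try easy.
  { intros t; apply Rlt_le, HP0. }
  assert (Hu : forall t, a <= t -> is_derive u t (P t * v t)) by (intros; apply Huv; lra).
  assert (Hv : forall t, a <= t -> is_derive v t (q t * u t)) by (intros; apply Huv; lra).
  assert (Hu1 : forall t, a <= t -> 1 <= u t) by (intros; apply Huv; lra).
  assert (Hv0 : forall t, a <= t -> 0 <= v t) by (intros; apply Huv; lra).
  set (g t := P t / u t ^ 2); set (G t := RInt g a t).
  assert (Hg : forall t, a <= t -> 0 < g t).
  { intros t Ht; apply Rdiv_lt_0_compat; [apply HP0|]; apply pow_lt; specialize (Hu1 t Ht); lra. }
  assert (HG : forall t, a <= t -> is_derive G t (g t)).
  { intros t Ht; apply is_derive_RInt_ray with (a - 1); try lra; intros s Hs.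
    destruct (Huv s Hs) as [Hus [_ [Hus1 _]]].
    apply continuous_Rmult; [apply HP|].
    apply (is_derive_continuous _ s (- (2 * u s * (P s * v s)) / (u s ^ 2) ^ 2)).
    evar_last; [apply is_derive_inv; [|apply pow_nonzero; lra]|].
    - apply (is_derive_pow u 2 s _ Hus).
    - simpl; field; lra. }
  assert (HGinc : forall s t, a <= s <= t -> G s <= G t).
  { apply (nondecreasing_of_derive G g a); [easy|]; intros t Ht; now apply Rlt_le, Hg. }
  assert (HGB : forall t, a <= t -> G t <= B).
  { intros t Ht; apply Rle_trans with (RInt P a t); [|now apply HB].
    enough (G t - RInt P a t <= G a - RInt P a a)
      by (unfold G in *; rewrite !RInt_point in *; lra).
    apply (nonincreasing_of_derive (fun t => G t - RInt P a t) (fun t => g t - P t) a); try lra.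
    - intros s Hs; apply (is_derive_minus G); [now apply HG|now apply is_derive_RInt_continuous].
    - intros s Hs; specialize (Hu1 s Hs); specialize (HP0 s).
      enough (g s <= P s) by lra.
      assert (1 <= u s ^ 2) by (simpl; nra).
      apply Rle_div_l; [lra|nra]. }
  destruct (completeness (fun z => exists t, a <= t /\ z = G t)) as [c [Hub Hlub]].
  { exists B; intros z [t [Ht ->]]; now apply HGB. }
  { exists (G a), a; split; [lra|easy]. }
  assert (HGc : forall t, a <= t -> G t < c).
  { intros t Ht.
    apply Rlt_le_trans with (G (t + 1)); [|apply Hub; exists (t + 1); split; [lra|easy]].
    destruct (MVT_gen G t (t + 1) g) as [z [Hz Heq]];
      rewrite Rmin_left, Rmax_right in * by lra.
    - intros z Hz; apply HG; lra.
    - intros z Hz; apply continuity_pt_filterlim.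
      apply (is_derive_continuous G z (g z)), HG; lra.
    - specialize (Hg z ltac:(lra)); lra. }
  (* The bound that yields y <= 0 when t runs to the supremum. *)
  assert (Htail : forall s t, a <= s -> a <= t -> v s * (G t - G s) <= / u s).
  { intros s t Hs Ht.
    assert (Hus := Hu1 s Hs); assert (Hvs := Hv0 s Hs).
    assert (0 < / u s) by (apply Rinv_0_lt_compat; lra).
    destruct (Rle_lt_dec t s) as [Hts|Hst].
    { assert (G t <= G s) by (apply HGinc; lra); nra. }
    assert (0 < / u t) by (apply Rinv_0_lt_compat; specialize (Hu1 t Ht); lra).
    enough (v s * G t + / u t <= v s * G s + / u s) by lra.
    apply (nonincreasing_of_derive (fun r => v s * G r + / u r)
             (fun r => v s * g r + - (P r * v r) / u r ^ 2) s); [| |lra].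
    - intros r Hr.
      apply (is_derive_plus (fun r => v s * G r) (fun r => / u r)).
      + apply is_derive_scal, HG; lra.
      + apply is_derive_inv; [apply Hu; lra|]; specialize (Hu1 r ltac:(lra)); lra.
    - intros r Hr.
      assert (v s <= v r).
      { apply (nondecreasing_of_derive v (fun r => q r * u r) a); [easy| |lra].
        intros z Hz; apply Rmult_le_pos; [apply Hq0|]; specialize (Hu1 z Hz); lra. }
      assert (Hgr := Hg r ltac:(lra)).
      replace (v s * g r + - (P r * v r) / u r ^ 2) with ((v s - v r) * g r).
      + nra.
      + unfold g; field; specialize (Hu1 r ltac:(lra)); lra. }
  exists (fun t => u t * (c - G t)), (fun t => v t * (c - G t) - / u t).
  intros t Ht.
  assert (Hut := Hu1 t Ht); assert (HcG := HGc t Ht).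
  assert (HdcG : is_derive (fun t => c - G t) t (- g t)).
  { now apply is_derive_const_minus, HG. }
  split; [|split; [|split]].
  - evar_last; [apply (is_derive_mult u (fun t => c - G t)); [now apply Hu|exact HdcG|]|].
    + intros; apply Rmult_comm.
    + unfold plus, mult; simpl; unfold g; field; lra.
  - evar_last.
    + apply (is_derive_minus (fun t => v t * (c - G t)) (fun t => / u t)).
      * apply (is_derive_mult v (fun t => c - G t)); [now apply Hv|exact HdcG|].
        intros; apply Rmult_comm.
      * apply is_derive_inv; [now apply Hu|lra].
    + unfold minus, plus, opp, mult; simpl; unfold g; field; lra.
  - apply Rmult_lt_0_compat; lra.
  - assert (Hvt := Hv0 t Ht).
    assert (0 < / u t) by (apply Rinv_0_lt_compat; lra).
    destruct (Rle_lt_or_eq_dec 0 (v t) Hvt) as [Hpos|<-]; [|lra].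
    enough (Hc : c <= G t + / u t / v t).
    { enough (c - G t <= / u t / v t) as Hd by (apply Rle_div_r in Hd; lra); lra. }
    apply Hlub; intros z [s [Hs ->]].
    enough (G s - G t <= / u t / v t) by lra.
    apply Rle_div_r; [easy|]; rewrite Rmult_comm; now apply Htail.
Qed.

(** Both limits rest on the same obstruction [Hkey] below: y is nonpositive and
    gains the integral of q x, so x cannot dominate a positive multiple of an f
    for which the integral of q f diverges. It is used with f = 1 to get
    x -> 0, and with f = pi to get y -> 0. *)
Lemma decaying_solution (P q : R -> R) (a l : R) :
  (forall t, continuous P t) -> (forall t, continuous q t) ->
  (forall t, 0 < P t) -> (forall t, 0 <= q t) ->
  is_lim (RInt P a) p_infty l ->
  is_lim (RInt q a) p_infty p_infty ->
  is_lim (RInt (fun t => q t * (l - RInt P a t)) a) p_infty p_infty ->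
  exists x y : R -> R,
    (forall t, a <= t ->
       is_derive x t (P t * y t) /\ is_derive y t (q t * x t) /\ 0 < x t) /\
    is_lim x p_infty 0 /\ is_lim y p_infty 0.
Proof.
  intros HP Hq HP0 Hq0 Hl HqI HqpiI.
  set (pi t := l - RInt P a t).
  assert (Hpi : forall t, is_derive pi t (- P t)).
  { intros t; now apply is_derive_const_minus, is_derive_RInt_continuous. }
  assert (Hpi0 : is_lim pi p_infty 0).
  { replace (Finite 0) with (Finite (l - l)) by (f_equal; ring).
    apply (is_lim_minus' (fun _ => l)); [apply is_lim_const|exact Hl]. }
  assert (HpiC : forall t, continuous pi t) by (intros t; eapply is_derive_continuous, Hpi).
  destruct (positive_decreasing_solution P q a l) as [x [y Hxy]]; try easy.
  { intros t Ht; apply (is_lim_le_loc (fun _ => RInt P a t) (RInt P a) p_infty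
                          (RInt P a t) l); [|apply is_lim_const|exact Hl].
    exists t; intros s Hs.
    apply (nondecreasing_of_derive (RInt P a) P a); [| |lra].
    - intros r _; now apply is_derive_RInt_continuous.
    - intros r _; now apply Rlt_le. }
  assert (Hx : forall t, a <= t -> is_derive x t (P t * y t)) by (intros; now apply Hxy).
  assert (Hy : forall t, a <= t -> is_derive y t (q t * x t)) by (intros; now apply Hxy).
  assert (Hx0 : forall t, a <= t -> 0 < x t) by (intros; now apply Hxy).
  assert (Hy0 : forall t, a <= t -> y t <= 0) by (intros; now apply Hxy).
  assert (Hkey : forall (f : R -> R) eps, 0 < eps -> (forall t, continuous f t) ->
            is_lim (RInt (fun t => q t * f t) a) p_infty p_infty ->
            ~ forall t, a <= t -> eps * f t <= x t).
  { intros f eps Heps Hf Hinf Hle.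
    apply (is_lim_p_infty_unbounded _ a (- y a / eps) Hinf); intros t Ht.
    apply Rle_div_r; [easy|].
    set (I t := RInt (fun t => q t * f t) a t).
    assert (HI : forall t, is_derive I t (q t * f t)).
    { intros s; apply (is_derive_RInt_continuous (fun t => q t * f t)).
      intros r; now apply continuous_Rmult. }
    enough (y a - eps * I a <= y t - eps * I t).
    { specialize (Hy0 t Ht); change (I t * eps <= - y a).
      replace (I a) with 0 in H by (unfold I; now rewrite RInt_point); lra. }
    apply (nondecreasing_of_derive (fun t => y t - eps * I t)
             (fun t => q t * x t - eps * (q t * f t)) a); [| |lra].
    - intros s Hs; apply (is_derive_minus y); [now apply Hy|apply is_derive_scal, HI].
    - intros s Hs; specialize (Hle s Hs); specialize (Hq0 s); nra. }
  exists x, y; split; [|split].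
  - intros t Ht; repeat split; try now apply Hxy.
  - apply (is_lim_0_nonincreasing x a).
    + apply (nonincreasing_of_derive x (fun t => P t * y t)); [easy|].
      intros t Ht; specialize (HP0 t); specialize (Hy0 t Ht); nra.
    + intros t Ht; now apply Rlt_le, Hx0.
    + intros eps Heps Hle; apply (Hkey (fun _ => 1) eps Heps).
      * intros t; apply continuous_const.
      * apply is_lim_ext with (2 := HqI); intros t.
        apply RInt_ext; intros; symmetry; apply Rmult_1_r.
      * intros t Ht; rewrite Rmult_1_r; now apply Hle.
  - assert (Hlim : is_lim (fun t => - y t) p_infty 0).
    { apply (is_lim_0_nonincreasing _ a).
      - intros s t Hst; apply Ropp_le_contravar.
        apply (nondecreasing_of_derive y (fun t => q t * x t) a); try easy.
        intros r Hr; apply Rmult_le_pos; [easy|now apply Rlt_le, Hx0].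
      - intros t Ht; specialize (Hy0 t Ht); lra.
      - intros eps Heps Hle; apply (Hkey pi eps Heps HpiC HqpiI).
        intros t Ht.
        assert (Hlim0 : is_lim (fun s => - (eps * pi s)) p_infty 0).
        { replace (Finite 0) with (Rbar_opp (Rbar_mult eps 0))
            by (simpl; f_equal; ring).
          now apply is_lim_opp, is_lim_scal_l. }
        enough (0 <= x t - eps * pi t) by lra.
        apply (is_lim_le_loc (fun s => - (eps * pi s)) (fun _ => x t - eps * pi t) p_infty 0
                 (x t - eps * pi t)); [|exact Hlim0|apply is_lim_const].
        exists t; intros s Hs.
        enough (x s - eps * pi s <= x t - eps * pi t) by (specialize (Hx0 s ltac:(lra)); lra).
        apply (nonincreasing_of_derive (fun t => x t - eps * pi t)
                 (fun t => P t * y t - eps * (- P t)) a); [| |lra].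
        + intros r Hr; apply (is_derive_minus x); [now apply Hx|apply is_derive_scal, Hpi].
        + intros r Hr; specialize (Hle r Hr); specialize (HP0 r); nra. }
    apply is_lim_opp in Hlim; simpl in Hlim; rewrite Ropp_0 in Hlim.
    apply is_lim_ext with (2 := Hlim); intros t; ring.
Qed.

(** * Equivalence of the divergence conditions *)

(** Here [l - RInt P a t] is pi(t), and [Hparts] below is the integration by
    parts; [Htail], with s sent to infinity, bounds the boundary term Q pi. *)
Lemma divergence_equivalence (P q : R -> R) (a l : R) :
  (forall t, continuous P t) -> (forall t, continuous q t) ->
  (forall t, 0 < P t) -> (forall t, 0 <= q t) ->
  is_lim (RInt P a) p_infty l ->
  is_lim (RInt (fun t => q t * (l - RInt P a t)) a) p_infty p_infty <->
  is_lim (RInt (fun t => RInt q a t * P t) a) p_infty p_infty.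
Proof.
  intros HP Hq HP0 Hq0 Hl.
  set (pi t := l - RInt P a t); set (Q t := RInt q a t).
  assert (HQ : forall t, is_derive Q t (q t)) by (intros t; now apply is_derive_RInt_continuous).
  assert (Hpi : forall t, is_derive pi t (- P t)).
  { intros t; now apply is_derive_const_minus, is_derive_RInt_continuous. }
  set (I t := RInt (fun t => q t * pi t) a t); set (J t := RInt (fun t => Q t * P t) a t).
  assert (HI : forall t, is_derive I t (q t * pi t)).
  { intros t; apply (is_derive_RInt_continuous (fun t => q t * pi t)); intros s.
    apply continuous_Rmult; [easy|eapply is_derive_continuous, Hpi]. }
  assert (HJ : forall t, is_derive J t (Q t * P t)).
  { intros t; apply (is_derive_RInt_continuous (fun t => Q t * P t)); intros s.
    apply continuous_Rmult; [eapply is_derive_continuous, HQ|easy]. }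
  assert (HQinc : forall s t, a <= s <= t -> Q s <= Q t)
    by (apply (nondecreasing_of_derive Q q); easy).
  assert (HQa : Q a = 0) by (unfold Q; now rewrite RInt_point).
  assert (HQ0 : forall t, a <= t -> 0 <= Q t).
  { intros t Ht; rewrite <- HQa; apply HQinc; lra. }
  assert (HJinc : forall s t, a <= s <= t -> J s <= J t).
  { apply (nondecreasing_of_derive J (fun t => Q t * P t)); [easy|].
    intros t Ht; apply Rmult_le_pos; [now apply HQ0|now apply Rlt_le]. }
  assert (Hparts : forall t, a <= t -> I t = Q t * pi t + J t).
  { intros t Ht.
    set (D t := I t - (Q t * pi t + J t)).
    assert (HD : forall s, is_derive D s 0).
    { intros s; evar_last.
      - apply (is_derive_minus I); [apply HI|].
        apply (is_derive_plus (fun s => Q s * pi s) J); [|apply HJ].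
        apply (is_derive_mult Q pi); [apply HQ|apply Hpi|intros; apply Rmult_comm].
      - unfold minus, plus, opp, mult; simpl; ring. }
    assert (D a <= D t).
    { apply (nondecreasing_of_derive D (fun _ => 0) a); try easy; intros; lra. }
    assert (D t <= D a).
    { apply (nonincreasing_of_derive D (fun _ => 0) a); try easy; intros; lra. }
    assert (D a = 0).
    { unfold D, I, J; rewrite !RInt_point, HQa; unfold zero; simpl; ring. }
    unfold D in *; lra. }
  assert (Htail : forall t s, a <= t <= s -> Q t * (pi t - pi s) <= J s).
  { intros t s Hts.
    enough (J t + Q t * pi t <= J s + Q t * pi s).
    { enough (0 <= J t) by lra.
      replace 0 with (J a) by (unfold J; now rewrite RInt_point).
      apply HJinc; lra. }
    apply (nondecreasing_of_derive (fun s => J s + Q t * pi s)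
             (fun s => Q s * P s + Q t * (- P s)) t); [| |lra].
    - intros r Hr; apply (is_derive_plus J (fun r => Q t * pi r)); [apply HJ|].
      apply is_derive_scal, Hpi.
    - intros r Hr; specialize (HQinc t r ltac:(lra)); specialize (HP0 r); nra. }
  assert (Hpi0 : is_lim pi p_infty 0).
  { replace (Finite 0) with (Finite (l - l)) by (f_equal; ring).
    apply (is_lim_minus' (fun _ => l)); [apply is_lim_const|exact Hl]. }
  split; intros Hinf.
  - apply (is_lim_p_infty_nondecreasing J a HJinc); intros B HB.
    apply (is_lim_p_infty_unbounded I a (B + B) Hinf); intros t Ht.
    rewrite Hparts by easy; apply Rplus_le_compat; [|now apply HB].
    replace (Q t * pi t) with (Q t * (pi t - 0)) by ring.
    apply (is_lim_le_loc (fun s => Q t * (pi t - pi s)) (fun _ => B) p_infty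
             (Q t * (pi t - 0)) B).
    + exists t; intros s Hs; apply Rle_trans with (J s); [apply Htail; lra|apply HB; lra].
    + apply (is_lim_scal_l _ (Q t) p_infty (pi t - 0)).
      apply is_lim_minus'; [apply is_lim_const|exact Hpi0].
    + apply is_lim_const.
  - apply is_lim_le_p_loc with (2 := Hinf).
    exists a; intros t Ht; change (J t <= I t).
    rewrite Hparts by lra.
    enough (0 <= pi t) by (specialize (HQ0 t ltac:(lra)); nra).
    apply (is_lim_le_loc pi (fun _ => pi t) p_infty 0 (pi t)); [|easy|apply is_lim_const].
    exists t; intros s Hs.
    apply (nonincreasing_of_derive pi (fun t => - P t) t); try easy; [|lra].
    intros r _; specialize (HP0 r); lra.
Qed.

(** * From the whole line to the half-line *)

Lemma continuous_clamp (f : R -> R) (a : R) :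
  continuous_on (half_line a) f -> forall t, continuous (fun s => f (Rmax a s)) t.
Proof.
  intros Hf t.
  apply (filterlim_comp _ _ _ (Rmax a) f (locally t)
           (within (half_line a) (locally (Rmax a t)))).
  - intros D HD; unfold within in HD.
    assert (Hmax : continuous (Rmax a) t).
    { apply continuous_ext with (fun s => (a + s + Rabs (s - a)) / 2).
      - intros s; unfold Rmax; destruct (Rle_dec a s);
          [rewrite Rabs_pos_eq|rewrite Rabs_left]; lra.
      - apply continuous_Rmult; [|apply continuous_const].
        apply (continuous_plus (fun s => a + s) (fun s => Rabs (s - a))).
        + apply (continuous_plus (fun _ => a)); [apply continuous_const|apply continuous_id].
        + apply (continuous_comp (fun s => s - a) Rabs); [|apply continuous_Rabs].
          apply (continuous_plus (fun s => s) (fun _ => - a)); [apply continuous_id|apply continuous_const]. }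
    specialize (Hmax _ HD); unfold filtermap in *.
    apply filter_imp with (2 := Hmax); intros s Hs; apply Hs, Rmax_l.
  - apply Hf, Rmax_l.
Qed.

(** Since t lies in D, the only point to which [within D (locally t)] can
    converge is t, and there the one-sided expansion is a restriction of the
    two-sided one. *)
Lemma is_derive_within_ext (D : R -> Prop) (f g : R -> R) (t l : R) :
  D t -> (forall s, D s -> f s = g s) -> is_derive f t l -> is_derive_within D g t l.
Proof.
  intros Ht Hfg [Hlin Hf]; split; [exact Hlin|]; intros u Hu.
  assert (Heq : t = u).
  { apply eq_close; intros eps; apply ball_sym.
    apply (locally_singleton t (fun s => D s -> ball u eps s)); [|exact Ht].
    apply (Hu (fun s => ball u eps s)); now exists eps. }
  subst u; intros eps; unfold within.
  apply filter_imp with (2 := Hf t (fun K HK => HK) eps); intros s Hs HDs.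
  rewrite <- !Hfg by easy; exact Hs.
Qed.

Lemma int_infinite_ext (f g : R -> R) (a : R) :
  (forall t, a <= t -> f t = g t) -> int_infinite f a -> int_infinite g a.
Proof.
  intros Hfg; apply is_lim_ext_loc; exists a; intros t Ht.
  apply RInt_ext; intros s; rewrite Rmin_left, Rmax_right by lra; intros Hs; apply Hfg; lra.
Qed.

Lemma int_infinite_ext_iff (f g : R -> R) (a : R) :
  (forall t, a <= t -> f t = g t) -> int_infinite f a <-> int_infinite g a.
Proof.
  intros Hfg; split; apply int_infinite_ext; [easy|]; intros; symmetry; now apply Hfg.
Qed.

Lemma int_to_infty_RInt (f : R -> R) (a : R) :
  (forall t, a <= t -> ex_RInt f a t) -> converges_int f a ->
  exists l : R, is_lim (RInt f a) p_infty l /\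
    forall t, a <= t -> int_to_infty f t = l - RInt f a t.
Proof.
  intros Hex [l Hl]; exists l; split.
  - intros D HD; destruct (Hl D HD) as [A B HA HB HAB].
    apply filter_imp with (2 := HB); intros t Ht.
    destruct (HAB a t HA Ht) as [z [Hz HDz]]; simpl in Hz.
    now rewrite (is_RInt_unique _ _ _ _ Hz).
  - intros t Ht; unfold Rminus; rewrite Rplus_comm; apply (is_RInt_gen_unique f).
    apply (is_RInt_gen_Chasles f a (opp (RInt f a t)) l); [|exact Hl].
    apply is_RInt_gen_at_point, (is_RInt_swap f), (RInt_correct f), Hex, Ht.
Qed.

Theorem theorem4p5 (a : R) (p q : R -> R)
  (ha : 0 <= a)
  (hp : continuous_on (half_line a) p)
  (hq : continuous_on (half_line a) q)
  (hp_pos : forall t, a <= t -> 0 < p t)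
  (hq_pos : forall t, a <= t -> 0 < q t)
  (hp_int : converges_int (fun t => / p t) a)
  (hq_int : int_infinite q a) :
  (int_infinite (fun t => q t * pi_tail p t) a <->
   int_infinite (fun t => Q_int q a t / p t) a) /\
  (int_infinite (fun t => q t * pi_tail p t) a ->
   (exists gamma : R, 0 < gamma < 1 /\
      exists T0 : R, a <= T0 /\ forall t, T0 <= t ->
        converges_int (fun s => q s * (pi_tail p s) ^ 2) t /\
        int_to_infty (fun s => q s * (pi_tail p s) ^ 2) t <= gamma * pi_tail p t) ->
   exists (T : R) (x dx : R -> R),
     a <= T /\
     is_solution p q T x dx /\
     (forall t, T <= t -> 0 < x t) /\
     is_decaying p x dx).
Proof.
  set (P t := / p (Rmax a t)); set (q' t := q (Rmax a t)).
  assert (HPp : forall t, a <= t -> P t = / p t)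
    by (intros t Ht; unfold P; now rewrite Rmax_right).
  assert (Hqq : forall t, a <= t -> q' t = q t)
    by (intros t Ht; unfold q'; now rewrite Rmax_right).
  assert (HP0 : forall t, 0 < P t) by (intros t; apply Rinv_0_lt_compat, hp_pos, Rmax_l).
  assert (Hq0 : forall t, 0 <= q' t) by (intros t; apply Rlt_le, hq_pos, Rmax_l).
  assert (HP : forall t, continuous P t).
  { intros t; apply (continuous_comp (fun s => p (Rmax a s)) Rinv).
    - now apply continuous_clamp.
    - apply continuous_Rinv, Rgt_not_eq, hp_pos, Rmax_l. }
  assert (Hq : forall t, continuous q' t) by now apply continuous_clamp.
  assert (HRP : forall t, a <= t -> RInt (fun s => / p s) a t = RInt P a t).
  { intros t Ht; apply RInt_ext; intros s; rewrite Rmin_left, Rmax_right by lra.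
    intros Hs; symmetry; apply HPp; lra. }
  assert (HRq : forall t, a <= t -> RInt q a t = RInt q' a t).
  { intros t Ht; apply RInt_ext; intros s; rewrite Rmin_left, Rmax_right by lra.
    intros Hs; symmetry; apply Hqq; lra. }
  destruct (int_to_infty_RInt (fun t => / p t) a) as [l [Hl Hpi]]; try easy.
  { intros t Ht; apply ex_RInt_ext with P.
    - intros s; rewrite Rmin_left, Rmax_right by lra; intros Hs; apply HPp; lra.
    - apply (ex_RInt_continuous P); intros; apply HP. }
  apply (is_lim_ext_loc _ (RInt P a)) in Hl; [|exists a; intros t Ht; apply HRP; lra].
  assert (Hqpi : forall t, a <= t -> q t * pi_tail p t = q' t * (l - RInt P a t)).
  { intros t Ht; unfold pi_tail; now rewrite Hpi, HRP, Hqq. }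
  assert (HQP : forall t, a <= t -> Q_int q a t / p t = RInt q' a t * P t).
  { intros t Ht; unfold Q_int; now rewrite HRq, HPp. }
  rewrite (int_infinite_ext_iff _ _ a Hqpi), (int_infinite_ext_iff _ _ a HQP).
  split; [apply (divergence_equivalence P q' a l); assumption|].
  intros Hinf _.
  destruct (decaying_solution P q' a l) as [x [y [Hxy [Hx Hy]]]]; try easy.
  { apply (int_infinite_ext q); [|easy]; intros t Ht; symmetry; now apply Hqq. }
  assert (Hqd : forall t, a <= t -> quasi_deriv p (fun s => P s * y s) t = y t).
  { intros t Ht; unfold quasi_deriv; rewrite HPp by easy.
    specialize (hp_pos t Ht); field; lra. }
  exists a, x, (fun t => P t * y t); split; [lra|split; [split|split; [|split]]].
  - exists a; split; [lra|]; apply Rgt_not_eq, Hxy; lra.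
  - intros t Ht; destruct (Hxy t Ht) as [Hdx [Hdy _]]; split.
    + now apply is_derive_within_ext with x.
    + rewrite <- Hqq by easy; apply is_derive_within_ext with y; try easy.
      intros s Hs; symmetry; now apply Hqd.
  - intros t Ht; now apply Hxy.
  - exact Hx.
  - apply is_lim_ext_loc with (2 := Hy); exists a; intros t Ht; symmetry; apply Hqd; lra.
Qed.
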